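(* Let $a,b>0$ and let $N$ be a nonnegative integer. For $x,y>0$ define $g_{x,y}(v)=x^{1-2v}y^{2v}$, $0\leq v\leq1$. (1) If $0\leq v\leq\frac12$, then $$(1-v)a+vb\ \geq\ \frac12\left(a^{1-2v}b^{2v}+a\right)+\frac12\sum_{n=1}^{N-1}r_{n}(v)\sum_{k=1}^{2^{n-1}}\Delta_{g_{a,b}}(n,k)\,\chi_{\left(\frac{k-1}{2^{n}},\frac{k}{2^{n}}\right)}(v),$$ $$(1-v)a+vb\ \leq\ a+\frac12 b-\frac12a^{2v}b^{1-2v}-\frac12\sum_{n=1}^{N-1}r_{n}(v)\sum_{k=1}^{2^{n-1}}\Delta_{g_{b,a}}(n,k)\,\chi_{\left(\frac{k-1}{2^{n}},\frac{k}{2^{n}}\right)}(v).$$ (2) If $\frac12<v\leq1$, then $$(1-v)a+vb\ \geq\ \frac12\left(a^{2-2v}b^{2v-1}+b\right)+\frac12\sum_{n=1}^{N-1}r_{n}(v)\sum_{k=1}^{2^{n-1}}\Delta_{g_{a,b}}(n,k)\,\chi_{\left(\frac{k-1}{2^{n}},\frac{k}{2^{n}}\right)}\left(v-\tfrac12\right),$$ $$(1-v)a+vb\ \leq\ \frac12a+b-\frac12a^{2v-1}b^{2-2v}-\frac12\sum_{n=1}^{N-1}r_{n}(v)\sum_{k=1}^{2^{n-1}}\Delta_{g_{b,a}}(n,k)\,\chi_{\left(\frac{k-1}{2^{n}},\frac{k}{2^{n}}\right)}\left(v-\tfrac12\right).$$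
   Context: The functions $r_n:[0,1]\to\mathbb{R}$ are defined recursively by $r_0(v)=\min\{v,1-v\}$ and $r_n(v)=\min\{2r_{n-1}(v),1-2r_{n-1}(v)\}$ for $n\ge 1$. For a function $f$ on $[0,1]$, $\Delta_f(n,k)=f\left(\frac{k-1}{2^n}\right)+f\left(\frac{k}{2^n}\right)-2f\left(\frac{2k-1}{2^{n+1}}\right)$. $\chi_I$ is the characteristic function of the interval $I$. A sum $\sum_{n=1}^{N-1}$ is zero when $N\le 1$. *)

(* Defs.v *)
From mathcomp Require Import all_boot all_order all_algebra.
From mathcomp Require Import all_classical all_reals all_analysis.

Set Implicit Arguments.
Unset Strict Implicit.
Unset Printing Implicit Defensive.

Import Order.TTheory GRing.Theory Num.Theory.

Local Open Scope ring_scope.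

(* Functions on [0, 1] are total functions on R; only their values on [0, 1]
   matter. *)

Fixpoint rfun (R : realType) (n : nat) (v : R) : R :=
  match n with
  | 0%N => Num.min v (1 - v)
  | m.+1 => Num.min (2 * rfun m v) (1 - 2 * rfun m v)
  end.

(* Since k%:R is taken in R, the subtraction k%:R - 1 is not truncated. *)
Definition Delta (R : realType) (f : R -> R) (n k : nat) : R :=
  f ((k%:R - 1) / 2 ^+ n) + f (k%:R / 2 ^+ n)
  - 2 * f ((2 * k%:R - 1) / 2 ^+ n.+1).

Definition chi (R : realType) (n k : nat) : R -> R :=
  \1_(`](k%:R - 1) / 2 ^+ n, k%:R / 2 ^+ n[%classic).

Definition geo (R : realType) (x y v : R) : R :=
  x `^ (1 - 2 * v) * y `^ (2 * v).

(* Main.v *)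
Require Import Defs.
From mathcomp Require Import all_boot all_order all_algebra.
From mathcomp Require Import all_classical all_reals all_analysis.
From mathcomp Require Import zify ring lra.

Import Order.TTheory GRing.Theory Num.Theory.

Local Open Scope ring_scope.

(** Write [f = geo a b], so that [f 0 = a] and [f (1/2) = b].  For [v] in
    [[0, 1/2]], [2 ((1 - v) a + v b)] equals [a] plus the chord
    [(1 - 2 v) a + 2 v b] of [f], and also [2 a + b] minus the same chord with
    [a] and [b] exchanged.  So both inequalities of the first part say that the
    chord dominates [f v] plus the correction sum ([geo_add_sum_le]).

    Let [L_n] be the function interpolating [f] linearly between consecutive
    points [k / 2 ^ n].  Halving the mesh lowers the interpolant by a tent on
    each interval, of height half the second difference [Delta f n k], and
    [rfun n] is exactly the tent of height 1/2 on each of these intervals.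
    Hence [L_n - L_(n+1)] is the n-th term of the correction sum, the sum
    telescopes, and the chord [L_1] minus the sum is [L_N]
    ([chord_sub_sum_dyadic]).  Since [f] is convex ([geo_convex]), [L_N]
    lies above [f].

    The second part follows from the same chord bound at [u = v - 1/2], because
    [2 ((1 - v) a + v b)] is then [b] plus the chord at [u], and [rfun n] has
    period 1/2 on [[0, 1]] for [n >= 1] ([rfun_shift]). *)

(** [geo a b] is [expR] composed with an affine function. *)
Lemma geo_convex {R : realType} {a b : R} (ha : 0 < a) (hb : 0 < b) (p q : R)
    {t : R} :
  0 <= t <= 1 ->
  geo a b ((1 - t) * p + t * q) <= (1 - t) * geo a b p + t * geo a b q.
Proof.
move=> /andP[t0 t1].
have geoE v : geo a b v = expR ((1 - 2 * v) * ln a + 2 * v * ln b).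
  by rewrite /geo /powR !gt_eqF// expRD.
rewrite !geoE.
have := convex_expR (Itv01 t0 t1) ((1 - 2 * q) * ln a + 2 * q * ln b)
  ((1 - 2 * p) * ln a + 2 * p * ln b).
rewrite !convRE /= => h; rewrite addrC [leRHS]addrC; apply: le_trans h.
rewrite le_eqVlt; apply/orP; left; apply/eqP; congr expR.
by rewrite /unstable.onem; ring.
Qed.

Lemma chiE {R : realType} (n k : nat) (v : R) :
  chi n k v = ((k%:R - 1 < 2 ^+ n * v) && (2 ^+ n * v < k%:R))%:R.
Proof.
have h : 0 < 2 ^+ n :> R by rewrite exprn_gt0.
rewrite /chi indicE; congr (nat_of_bool _)%:R.
rewrite mem_setE in_itv /= ltr_pdivrMr// ltr_pdivlMr//.
by rewrite (mulrC v).
Qed.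

(** The open dyadic intervals of level [n] are disjoint, so only the one
    containing [v] contributes; if [v] is an endpoint then no interval does, but
    the factor [Num.min t (1 - t)] vanishes as well. *)
Lemma sum_chi_dyadic {R : realType} {D : nat -> R} {n k m : nat} {v t : R} :
  (1 <= k < m)%N -> 0 <= t <= 1 -> 2 ^+ n * v = k%:R - 1 + t ->
  Num.min t (1 - t) * \sum_(1 <= j < m) D j * chi n j v
  = Num.min t (1 - t) * D k.
Proof.
move=> /andP[k1 km] /andP[t0 t1] defv.
have [->|tn0] := eqVneq t 0; first by rewrite subr0 min_l ?ler01// !mul0r.
have [->|tn1] := eqVneq t 1; first by rewrite subrr min_r ?ler01// !mul0r.
have tgt0 : 0 < t by rewrite lt_neqAle eq_sym tn0.
have tlt1 : t < 1 by rewrite lt_neqAle tn1.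
congr (_ * _).
rewrite (bigD1_seq k) ?iota_uniq ?mem_index_iota ?k1//=.
rewrite big1 ?addr0 => [|j jk].
  rewrite chiE defv.
  have -> : k%:R - 1 < k%:R - 1 + t by lra.
  have -> : k%:R - 1 + t < k%:R by lra.
  by rewrite mulr1.
rewrite chiE defv; case: andP => [[lj uj]|_]; last by rewrite mulr0.
have kj : (k < j.+1)%N by rewrite -(ltr_nat R) -natr1; lra.
have jk' : (j < k.+1)%N by rewrite -(ltr_nat R) -natr1; lra.
by rewrite eqn_leq (ltnSE kj) (ltnSE jk') in jk.
Qed.

(** The telescoping identity, located on the interval of level [N.+1] that
    contains [v]: [t] is the relative position of [v] in that interval, so the
    last equation says that the chord over [[0, 1/2]] minus the correction sum
    is the linear interpolant at level [N.+1].  The tent formula for [rfun] has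
    to be carried along, as it identifies the next term of the sum. *)
Lemma chord_sub_sum_dyadic {R : realType} (f : R -> R) (N : nat) {v : R} :
  0 <= v <= 1 / 2 ->
  exists k t, [/\ (1 <= k < (2 ^ N).+1)%N, 0 <= t <= 1,
    2 ^+ N.+1 * v = k%:R - 1 + t, rfun N.+1 v = Num.min t (1 - t)
  & (1 - 2 * v) * f 0 + 2 * v * f (1 / 2)
    - \sum_(1 <= n < N.+1) rfun n v *
        \sum_(1 <= k < (2 ^ n.-1).+1) Delta f n k * chi n k v
    = (1 - t) * f ((k%:R - 1) / 2 ^+ N.+1) + t * f (k%:R / 2 ^+ N.+1)].
Proof.
move=> /andP[v0 v1]; elim: N => [|N [k [t [/andP[k1 kN] /andP[t0 t1] defv rE IH]]]].
  exists 1%N, (2 * v); split => //.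
  - by apply/andP; split; lra.
  - by rewrite expr1; ring.
  - by rewrite /= [Num.min v _]min_l//; lra.
  - by rewrite big_geq// subrr mul0r subr0 expr1.
have t01 : 0 <= t <= 1 by rewrite t0.
have rS m : rfun m.+1 v = Num.min (2 * rfun m v) (1 - 2 * rfun m v) by [].
have sumE := sum_chi_dyadic (D := Delta f N.+1) (m := (2 ^ N).+1)
  (introT andP (conj k1 kN)) t01 defv.
have h2 : 2 ^+ N.+1 != 0 :> R by rewrite expf_neq0.
have midE x : (2 * x) / 2 ^+ N.+2 = x / 2 ^+ N.+1 :> R.
  by rewrite (exprS _ N.+1); field.
have endE : 2 * k%:R - 1 - 1 = 2 * (k%:R - 1) :> R by ring.
(* The new interval is the half of the old one on which v lies. *)
have [th|th] := leP (2 * t) 1.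
- exists (2 * k).-1, (2 * t).
  have kE : (2 * k).-1%:R = 2 * k%:R - 1 :> R.
    by rewrite -subn1 natrB ?muln_gt0// natrM.
  split.
  + by rewrite expnS; lia.
  + by apply/andP; split; lra.
  + by rewrite exprS -mulrA defv kE; ring.
  + by rewrite rS rE [Num.min t _]min_l//; lra.
  + rewrite big_nat_recr// opprD addrA IH rE sumE kE endE midE.
    rewrite min_l; last lra.
    by rewrite /Delta; ring.
- exists (2 * k)%N, (2 * t - 1).
  have kE : (2 * k)%:R = 2 * k%:R :> R by rewrite natrM.
  split.
  + by rewrite expnS; lia.
  + by apply/andP; split; lra.
  + by rewrite exprS -mulrA defv kE; ring.
  + rewrite rS rE [Num.min t _]min_r; last lra.
    by rewrite minC; congr Num.min; ring.
  + rewrite big_nat_recr// opprD addrA IH rE sumE kE midE.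
    rewrite min_r; last lra.
    by rewrite /Delta; ring.
Qed.

(** Refined Young inequality in normalized form; all four bounds of the theorem
    are instances of it. *)
Lemma geo_add_sum_le {R : realType} {a b : R} (N : nat) {v : R} :
  0 < a -> 0 < b -> 0 <= v <= 1 / 2 ->
  geo a b v + \sum_(1 <= n < N) rfun n v *
    \sum_(1 <= k < (2 ^ n.-1).+1) Delta (geo a b) n k * chi n k v
  <= (1 - 2 * v) * a + 2 * v * b.
Proof.
move=> ha hb hv.
have geo0 : geo a b 0 = a.
  by rewrite /geo mulr0 subr0 powRr0 powRr1 ?mulr1// ltW.
have geo_half : geo a b (1 / 2) = b.
  by rewrite /geo mul1r divff// subrr powRr0 powRr1 ?mul1r// ltW.
(* The sum is empty for both N = 0 and N = 1. *)
wlog [M ->] : N / exists M, N = M.+1.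
  case: N => [|M] W; last by apply: W; exists M.
  by have := W 1%N (ex_intro _ 0%N erefl); rewrite !big_geq.
have [k [t [_ ht defv _]]] := chord_sub_sum_dyadic (geo a b) M hv.
rewrite geo0 geo_half -lerBrDr => ->.
have h2 : 2 ^+ M.+1 != 0 :> R by rewrite expf_neq0.
apply: le_trans (geo_convex ha hb _ _ ht).
suff <- : v = (1 - t) * ((k%:R - 1) / 2 ^+ M.+1) + t * (k%:R / 2 ^+ M.+1) by [].
by apply: (mulfI h2); rewrite defv; field.
Qed.

(** [rfun 0] sends [v] and [v - 1/2] to values with sum [1/2], and the
    recursion is symmetric under [x |-> 1/2 - x]. *)
Lemma rfun_shift {R : realType} (n : nat) {v : R} :
  1 / 2 < v <= 1 -> rfun n.+1 v = rfun n.+1 (v - 1 / 2).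
Proof.
move=> /andP[v0 v1]; elim: n => [|n IH].
  rewrite /= [Num.min v _]min_r; last lra.
  rewrite [Num.min (v - _) _]min_l; last lra.
  by rewrite minC; congr Num.min; field.
have rS w : rfun n.+2 w = Num.min (2 * rfun n.+1 w) (1 - 2 * rfun n.+1 w) by [].
by rewrite !rS IH.
Qed.

Theorem theorem11 (R : realType) (a b : R) (N : nat) (ha : 0 < a) (hb : 0 < b) :
  (forall v : R, 0 <= v <= 1 / 2 ->
    (1 - v) * a + v * b >=
      1 / 2 * (a `^ (1 - 2 * v) * b `^ (2 * v) + a)
      + 1 / 2 * \sum_(1 <= n < N) rfun n v *
          \sum_(1 <= k < (2 ^ n.-1).+1) Delta (geo a b) n k * chi n k v
    /\
    (1 - v) * a + v * b <=
      a + 1 / 2 * b - 1 / 2 * (a `^ (2 * v) * b `^ (1 - 2 * v))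
      - 1 / 2 * \sum_(1 <= n < N) rfun n v *
          \sum_(1 <= k < (2 ^ n.-1).+1) Delta (geo b a) n k * chi n k v)
  /\
  (forall v : R, 1 / 2 < v <= 1 ->
    (1 - v) * a + v * b >=
      1 / 2 * (a `^ (2 - 2 * v) * b `^ (2 * v - 1) + b)
      + 1 / 2 * \sum_(1 <= n < N) rfun n v *
          \sum_(1 <= k < (2 ^ n.-1).+1) Delta (geo a b) n k * chi n k (v - 1 / 2)
    /\
    (1 - v) * a + v * b <=
      1 / 2 * a + b - 1 / 2 * (a `^ (2 * v - 1) * b `^ (2 - 2 * v))
      - 1 / 2 * \sum_(1 <= n < N) rfun n v *
          \sum_(1 <= k < (2 ^ n.-1).+1) Delta (geo b a) n k * chi n k (v - 1 / 2)).
Proof.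
split=> v hv.
  have := geo_add_sum_le N ha hb hv; have := geo_add_sum_le N hb ha hv.
  rewrite [a `^ (2 * v) * _]mulrC -!/(geo _ _ _) => hba hab.
  by split; lra.
have hu : 0 <= v - 1 / 2 <= 1 / 2.
  by case/andP: hv => v0 v1; apply/andP; split; lra.
have sum_shift (F : nat -> R) : \sum_(1 <= n < N) rfun n v * F n =
    \sum_(1 <= n < N) rfun n (v - 1 / 2) * F n.
  by apply: eq_big_nat => -[|n]// _; rewrite rfun_shift.
rewrite !sum_shift.
have := geo_add_sum_le N ha hb hu; have := geo_add_sum_le N hb ha hu.
have e1 : 2 - 2 * v = 1 - 2 * (v - 1 / 2) by field.
have e2 : 2 * v - 1 = 2 * (v - 1 / 2) by field.
rewrite e1 e2 [a `^ (2 * _) * _]mulrC -!/(geo _ _ _) => hba hab.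
by split; lra.
Qed.
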